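(* Let $G$ be a loop directed graph with vertex set $V$ and let $B_G=(V,V',E)$ be its associated bipartite graph. Let $i_1,\dots,i_t\in V$ and $j_1,\dots,j_t\in V'$. Then $V\setminus\{i_1,\dots,i_t\}$ is a zero forcing set of $G$ with chronological list of forces $j_1\to i_1,\ j_2\to i_2,\ \dots,\ j_t\to i_t$ if and only if $\mathcal{M}=\{\{i_1,j_1\},\dots,\{i_t,j_t\}\}$ is a constrained matching in $B_G$ whose indexing satisfies $\{i_k,j_l\}\notin E$ for all $1\le l<k\le t$.
   Context: A loop directed graph is a finite directed graph in which loops are allowed. The bipartite graph $B_G=(V,V',E)$ associated with $G$ has two copies $V$ and $V'$ of the vertex set of $G$ (a vertex $v$ of $G$ appears as $i_v\in V$ and $j_v\in V'$), and $\{i_s,j_t\}\in E$ iff there is a directed edge from vertex $t$ to vertex $s$ in $G$; in the forces $j_k\to i_k$ the elements of $V,V'$ are identified with the corresponding vertices of $G$. A $t$-matching is a set of $t$ pairwise disjoint edges; it is constrained if no other $t$-matching has the same set of matched vertices. Color change rule in a loop directed graph: each vertex is black or white; if exactly one out-neighbor $j$ of vertex $i$ is white (possibly $j=i$; $i$ need not be black), then $j$ is turned black, and we say $i$ forces $j$, written $i\to j$. A zero forcing set is a set $S$ such that starting with exactly $S$ black and applying the rule repeatedly, all vertices become black; a chronological list of forces is a list of the forces in the order in which they are performed to turn all vertices black. *)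

(* Defs.v *)
From mathcomp Require Import all_boot.

Set Implicit Arguments.
Unset Strict Implicit.
Unset Printing Implicit Defensive.

Section LoopDigraph.

(* A loop directed graph on T is an arbitrary relation e : rel T, where e u v
   is the directed edge from u to v (possibly u = v). *)
Variables (T : finType) (e : rel T).

Implicit Types (B S : {set T}) (u v : T).

Definition white_out_neighbors B u : {set T} := [set w | e u w & w \notin B].

(* The forcing vertex u need not belong to the black set B. *)
Definition forces B u v : bool := white_out_neighbors B u == [set v].

Definition color_change : rel {set T} :=
  fun B B' => [exists u, exists v, forces B u v && (B' == v |: B)].

Definition zero_forcing_set S : bool := connect color_change S [set: T].

(* The pair (u, v) in the list stands for the force u -> v. *)
Fixpoint chronological_list S (s : seq (T * T)) : bool :=
  if s is (u, v) :: s' then forces S u v && chronological_list (v |: S) s'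
  else S == [set: T].

(* In B_G, the copy of v in V is inl v and the copy of v in V' is inr v. *)
Definition bip_pair (s t : T) : {set T + T} := [set inl s; inr t].

(* {i_s, j_t} is an edge iff G has a directed edge from t to s. *)
Definition bip_edges : {set {set T + T}} :=
  [set bip_pair p.1 p.2 | p : T * T & e p.2 p.1].

End LoopDigraph.

Section Matchings.

Variables (W : finType) (E : {set {set W}}).

Definition t_matching (t : nat) (M : {set {set W}}) : bool :=
  [&& M \subset E, trivIset M & #|M| == t].

(* The set of vertices matched by M is cover M. *)
Definition constrained_matching (M : {set {set W}}) : Prop :=
  t_matching #|M| M /\
  forall M' : {set {set W}},
    t_matching #|M| M' -> cover M' = cover M -> M' = M.

End Matchings.

(* Main.v *)
Require Import Defs.
From mathcomp Require Import all_boot.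

Set Implicit Arguments.
Unset Strict Implicit.
Unset Printing Implicit Defensive.

(** Both sides say that the incidence pattern e (j l) (i k) is triangular with
    nonzero diagonal: e (j k) (i k) for all k, and no edge from j l to i k when
    l < k.  For forces, this is because the white vertices at the time of the
    l-th force are exactly the i k with l <= k.  For matchings, a triangular
    pattern admits only one perfect matching, as j k must be matched to some
    i m with m <= k, and those with m < k are already taken by j m. *)

Section Forcing.

Variables (T : finType) (e : rel T).

(** Each entry of the list is one [color_change] step, so the list traces a path from [S] to the
    full set. *)
Lemma chronological_zero_forcing (S : {set T}) (s : seq (T * T)) :
  chronological_list e S s -> zero_forcing_set e S.
Proof.
elim: s S => [|[u v] s IHs] S /=; first by move/eqP->; exact: connect0.
case/andP=> Fuv /IHs; apply: connect_trans; apply: connect1.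
by apply/existsP; exists u; apply/existsP; exists v; rewrite Fuv eqxx.
Qed.

(** Just before each force the white vertices are the targets still to come, so the forcing vertex
    must see its own target and none of the later ones. *)
Lemma chronological_listE (S : {set T}) (s : seq (T * T)) :
  chronological_list e S s =
  [&& S == ~: [set x in unzip2 s], all (fun p => e p.1 p.2) s
    & pairwise (fun p q => ~~ e p.1 q.2) s].
Proof.
elim: s S => [|[u v] s IHs] S /=.
  by rewrite andbT; congr (_ == _); apply/setP => x; rewrite !inE.
rewrite {}IHs; apply/idP/idP.
  case/and4P=> /eqP Fuv /eqP/setP defS -> ->.
  (* Since [v] is white in [S], removing it from [v |: S] gives back [S]. *)
  have : v \in white_out_neighbors e S u by rewrite Fuv set11.
  rewrite inE => /andP[euv vS]; rewrite euv !andbT /=; apply/andP; split.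
    apply/eqP/setP => x; have := defS x; rewrite !inE.
    by case: eqP => [-> _|_ /= ->//]; rewrite (negPf vS).
  (* A later target is white in [v |: S], hence white in [S] and distinct from [v]; an edge from [u]
     would make it a second white out-neighbor. *)
  apply/allP => q qs /=; apply/negP => euq.
  have := defS q.2; rewrite !inE (map_f snd qs) => /norP[qv qS].
  by move/setP/(_ q.2): Fuv; rewrite !inE euq qS (negPf qv).
case/and3P=> /eqP defS /andP[euv ->] /andP[/allP nus ->]; rewrite !andbT.
(* Targets cannot repeat: [u] sees [v] but no later target. *)
have vs : v \notin unzip2 s.
  by apply/mapP => -[q /nus /= nuq defv]; rewrite -defv euv in nuq.
apply/andP; split; last first.
  by apply/eqP/setP => x; rewrite defS !inE; case: eqP => // ->; rewrite vs.
apply/eqP/setP => x; rewrite defS !inE negbK; case: eqP => [->|_] /=.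
  by rewrite euv.
by apply/andP => -[eux /mapP[q /nus nuq defx]]; rewrite defx (negPf nuq) in eux.
Qed.

End Forcing.

Lemma pairwise_enum_ord (t : nat) (r : rel 'I_t) :
  reflect (forall l k : 'I_t, l < k -> r l k) (pairwise r (enum 'I_t)).
Proof.
apply: (iffP idP) => [pr l k lk | rlt].
  move/(pairwiseP l): pr => /(_ l k); rewrite !inE size_enum_ord !nth_ord_enum.
  exact.
have := iota_ltn_sorted 0 t; rewrite -val_enum_ord (sorted_pairwise ltn_trans).
rewrite pairwise_map; exact: sub_pairwise.
Qed.

Definition triangular (T : finType) (e : rel T) (t : nat) (i j : 'I_t -> T) :=
  (forall k, e (j k) (i k)) /\ (forall l k : 'I_t, l < k -> ~~ e (j l) (i k)).

Lemma chronological_triangular (T : finType) (e : rel T) (t : nat)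
    (i j : 'I_t -> T) :
  chronological_list e (~: [set i k | k : 'I_t])
    [seq (j k, i k) | k <- enum 'I_t] <-> triangular e i j.
Proof.
rewrite chronological_listE pairwise_map all_map /triangular.
have -> : [set x in unzip2 [seq (j k, i k) | k <- enum 'I_t]]
          = [set i k | k : 'I_t].
  apply/setP => x; rewrite inE /unzip2 -map_comp.
  apply/mapP/imsetP => -[k _ ->]; exists k => //; exact: mem_enum.
rewrite eqxx /=; split.
  case/andP=> /allP diag /pairwise_enum_ord tri; split=> // k.
  by apply: (diag k); rewrite mem_enum.
case=> diag tri; apply/andP; split; first by apply/allP => k _; exact: diag.
exact/pairwise_enum_ord.
Qed.

Section Bipartite.

Variables (T : finType) (e : rel T).

Lemma in_bip_inl (x s u : T) : (inl x \in bip_pair s u) = (x == s).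
Proof. by rewrite !inE orbF. Qed.

Lemma in_bip_inr (x s u : T) : (inr x \in bip_pair s u) = (x == u).
Proof. by rewrite !inE. Qed.

Lemma bip_pair_inj (s u s' u' : T) :
  bip_pair s u = bip_pair s' u' -> s = s' /\ u = u'.
Proof.
move/setP=> eqb; split; apply/eqP.
  by rewrite -(in_bip_inl s s' u') -eqb in_bip_inl.
by rewrite -(in_bip_inr u s' u') -eqb in_bip_inr.
Qed.

Lemma mem_bip_edges (s u : T) : (bip_pair s u \in bip_edges e) = e u s.
Proof.
apply/imsetP/idP => [[[s' u']] | eus]; last by exists (s, u); rewrite ?inE.
by rewrite inE => /= eus /bip_pair_inj[-> ->].
Qed.

Lemma bip_edgesP (A : {set T + T}) :
  A \in bip_edges e -> exists s u, A = bip_pair s u.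
Proof. by case/imsetP=> -[s u] _ ->; exists s, u. Qed.

Variables (t : nat) (i j : 'I_t -> T).

Local Notation M := [set bip_pair (i k) (j k) | k : 'I_t].

Lemma cover_inl (x : T) : inl x \in cover M -> exists k, x = i k.
Proof.
by case/bigcupP=> _ /imsetP[k _ ->]; rewrite in_bip_inl => /eqP; exists k.
Qed.

Lemma in_cover_inr (k : 'I_t) : inr (j k) \in cover M.
Proof.
apply/bigcupP; exists (bip_pair (i k) (j k)); last by rewrite in_bip_inr.
by apply/imsetP; exists k.
Qed.

Hypothesis tri : triangular e i j.

(** A repeated value, of [i] or likewise of [j], would identify a diagonal entry of the pattern with
    one that must vanish. *)
Lemma triangular_inj_i : injective i.
Proof.
have [diag off] := tri; move=> k l eqi; apply/val_inj.
by case: (ltngtP k l) => // /off; rewrite -?eqi ?diag // eqi diag.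
Qed.

Lemma triangular_inj_j : injective j.
Proof.
have [diag off] := tri; move=> k l eqj; apply/val_inj.
by case: (ltngtP k l) => // /off; rewrite -?eqj ?diag // eqj diag.
Qed.

Lemma triangular_t_matching : t_matching (bip_edges e) #|M| M.
Proof.
have [diag _] := tri; apply/and3P; split=> //.
  by apply/subsetP => _ /imsetP[k _ ->]; rewrite mem_bip_edges.
apply/trivIsetP => _ _ /imsetP[k _ ->] /imsetP[l _ ->] neq.
apply/pred0P => -[x|x] /=; rewrite ?in_bip_inl ?in_bip_inr.
  apply: contraNF neq => /andP[/eqP-> /eqP/triangular_inj_i->]; exact: eqxx.
apply: contraNF neq => /andP[/eqP-> /eqP/triangular_inj_j->]; exact: eqxx.
Qed.

(** Strong induction on the index [k] of the edge. Inclusion suffices for uniqueness, because the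
    competing matching has the same cardinality. *)
Lemma triangular_sub_cover (M' : {set {set T + T}}) :
  M' \subset bip_edges e -> trivIset M' -> cover M' = cover M -> M \subset M'.
Proof.
have [diag off] := tri; move=> /subsetP sM'E trivM' covM'.
suff inM' n (k : 'I_t) : k = n :> nat -> bip_pair (i k) (j k) \in M'.
  by apply/subsetP => _ /imsetP[k _ ->]; apply: inM'.
elim/ltn_ind: n k => n IHn k defn.
have := in_cover_inr k; rewrite -covM' => /bigcupP[A AM'].
have [s [u defA]] := bip_edgesP (sM'E _ AM').
rewrite {A}defA in AM' *; rewrite in_bip_inr => /eqP defu; subst u.
(* The other end of the edge of [M'] at [j k] is matched by [M] too, as the covers agree. *)
have [m defs] : exists m, s = i m.
  apply: cover_inl; rewrite -covM'; apply/bigcupP.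
  by exists (bip_pair s (j k)); rewrite ?in_bip_inl.
subst s; have := sM'E _ AM'; rewrite mem_bip_edges => ejkim.
have [mk | km | /val_inj eqmk] := ltngtP m k; last by rewrite -{1}eqmk.
2: by have := off _ _ km; rewrite ejkim.
have mM' : bip_pair (i m) (j m) \in M' by apply: (IHn m); rewrite // -defn.
(* Both edges lie in [M'] and contain [i m], so by disjointness both are the block of
   [inl (i m)]. *)
have : bip_pair (i m) (j m) = bip_pair (i m) (j k).
  rewrite -(def_pblock (x := inl (i m)) trivM' mM') ?in_bip_inl //.
  by apply: def_pblock; rewrite ?in_bip_inl.
by case/bip_pair_inj=> _ /triangular_inj_j eqmk; rewrite eqmk ltnn in mk.
Qed.

Lemma triangular_constrained : constrained_matching (bip_edges e) M.
Proof.
split=> [|M' /and3P[sM'E trivM' /eqP cardM'] covM'].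
  exact: triangular_t_matching.
by apply/esym/eqP; rewrite eqEcard triangular_sub_cover //= cardM'.
Qed.

End Bipartite.

Theorem theorem5p4 (T : finType) (e : rel T) (t : nat) (i j : 'I_t -> T) :
  (zero_forcing_set e (~: [set i k | k : 'I_t]) /\
   chronological_list e (~: [set i k | k : 'I_t])
     [seq (j k, i k) | k <- enum 'I_t])
  <->
  (constrained_matching (bip_edges e) [set bip_pair (i k) (j k) | k : 'I_t] /\
   forall k l : 'I_t, l < k -> bip_pair (i k) (j l) \notin bip_edges e).
Proof.
split=> [[_ /chronological_triangular tri] | [[/and3P[/subsetP sME _ _] _] off]].
  split; first exact: triangular_constrained.
  by move=> k l lk; rewrite mem_bip_edges; have [_] := tri; apply.
suff chron : chronological_list e (~: [set i k | k : 'I_t])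
    [seq (j k, i k) | k <- enum 'I_t].
  by split=> //; exact: chronological_zero_forcing chron.
(* The diagonal comes from the matching consisting of edges of [B_G], the vanishing part from the
   condition on the indexing. *)
apply/chronological_triangular; split=> [k | l k lk].
  by rewrite -mem_bip_edges sME //; apply/imsetP; exists k.
by rewrite -mem_bip_edges off.
Qed.
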